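(* There exists a self-conformal IFS $\Phi$ on $[0,1]$ such that: 1. $\Phi$ is of class $C^\infty([0,1])$ (every map of $\Phi$ is $C^\infty$ on $[0,1]$); 2. $\Phi$ is not $C^1$-conjugate to a self-similar IFS; 3. there exists a non-trivial (i.e. not a point mass) self-conformal measure with respect to $\Phi$ that is not Rajchman.
   Context: A self-conformal IFS on $[0,1]$ is a finite family $\Phi=\{f_1,\dots,f_n\}$ of maps $f_i:[0,1]\to[0,1]$ with $f_i\in C^1([0,1])$ and $|f_i'(x)|\in(0,1)$ for every $x\in[0,1]$. Its attractor is the unique nonempty compact set $X_\Phi\subseteq[0,1]$ with $X_\Phi=\bigcup_{i=1}^n f_i(X_\Phi)$. Standing assumption: there are $f_i,f_j\in\Phi$ that do not share the same fixed point (so $X_\Phi$ is infinite). If all the maps $f_i$ are affine, $\Phi$ is called a self-similar IFS. A Borel probability measure $\mu$ on $[0,1]$ is self-conformal with respect to $\Phi$ if there is a strictly positive probability vector $\mathbf p=(p_1,\dots,p_n)$ with $\mu=\sum_{i=1}^n p_i\cdot f_i\mu$, where $f_i\mu$ is the push-forward of $\mu$ by $f_i$. $\Phi$ is $C^r$-conjugate to an IFS $\Psi$ if there is a $C^r$ diffeomorphism $h$ of the interval such that $\Psi=\{h\circ f_i\circ h^{-1}: f_i\in\Phi\}$. The Fourier transform of a Borel probability measure $\mu$ on $\mathbb R$ is $\widehat\mu(\xi)=\int_{\mathbb R}e^{-2\pi i\xi t}\,d\mu(t)$; $\mu$ is Rajchman if $\lim_{|\xi|\to\infty}\widehat\mu(\xi)=0$.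 *)

(* Defs.v *)
From HB Require Import structures.
From mathcomp Require Import all_boot all_order all_algebra.
From mathcomp Require Import all_classical all_reals all_analysis.
From mathcomp Require Import complex.

Set Implicit Arguments.
Unset Strict Implicit.
Unset Printing Implicit Defensive.

Import Order.TTheory GRing.Theory Num.Theory numFieldNormedType.Exports.

Local Open Scope classical_set_scope.
Local Open Scope ring_scope.

(* A map on [0,1] is represented by a total function R -> R; no definition
   below depends on its values outside [0,1]. *)

Section smoothness.
Context {R : realType}.

Definition I01 : set R := `[0, 1].

Definition quotient_near (f : R -> R) (x : R) :=
  (f y - f x) / (y - x) @[y --> within I01 x^'].

(* Derivative relative to [0,1]: one-sided at the endpoints 0 and 1. *)
Definition derivable01 (f : R -> R) (x : R) : Prop := cvg (quotient_near f x).

Definition derive01 (f : R -> R) (x : R) : R := lim (quotient_near f x).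

Definition Cr01 (r : nat) (f : R -> R) : Prop :=
  forall k, (k <= r)%N ->
    {within I01, continuous (iter k derive01 f)} /\
    ((k < r)%N -> forall x, I01 x -> derivable01 (iter k derive01 f) x).

Definition Cinfty01 (f : R -> R) : Prop := forall r, Cr01 r f.

Definition Cr_diffeo01 (r : nat) (h k : R -> R) : Prop :=
  [/\ set_fun I01 I01 h /\ set_fun I01 I01 k,
      forall x, I01 x -> k (h x) = x,
      forall x, I01 x -> h (k x) = x,
      Cr01 r h & Cr01 r k].

End smoothness.

Section ifs.
Context {R : realType}.

(* The last clause is the standing assumption that two of the maps do not
   share the same fixed point. *)
Definition self_conformal_ifs n (Phi : 'I_n -> R -> R) : Prop :=
  (forall i, [/\ set_fun I01 I01 (Phi i), Cr01 1 (Phi i) &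
                 forall x, I01 x -> 0 < `|derive01 (Phi i) x| < 1]) /\
  (exists i j, ~ exists x, [/\ I01 x, Phi i x = x & Phi j x = x]).

Definition affine01 (f : R -> R) : Prop :=
  exists a b, forall x, I01 x -> f x = a * x + b.

Definition self_similar_ifs n (Phi : 'I_n -> R -> R) : Prop :=
  self_conformal_ifs Phi /\ forall i, affine01 (Phi i).

(* Psi = {h o f o h^-1 : f in Phi} is an equality of sets of maps of [0,1]:
   the indexings, and possible repetitions, are irrelevant. *)
Definition Cr_conjugate (r : nat) n m
    (Phi : 'I_n -> R -> R) (Psi : 'I_m -> R -> R) : Prop :=
  exists h k, [/\ Cr_diffeo01 r h k,
    forall i, exists j, forall x, I01 x -> Psi j x = h (Phi i (k x)) &
    forall j, exists i, forall x, I01 x -> Psi j x = h (Phi i (k x))].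

End ifs.

Section measures.
Context {R : realType}.
Implicit Type mu : probability (measurableTypeR R) R.

(* mu is carried by [0,1]; restricting to [0,1] before pushing forward makes
   the values of the map outside [0,1] irrelevant. *)
Definition pushforward01 mu (f : R -> R) : set (measurableTypeR R) -> \bar R :=
  pushforward (mrestr mu (measurable_itv `[0, 1]))
    (f : measurableTypeR R -> measurableTypeR R).

Definition self_conformal_measure n (Phi : 'I_n -> R -> R) mu : Prop :=
  mu I01 = 1%E /\
  exists p : 'I_n -> R,
    [/\ forall i, 0 < p i, \sum_(i < n) p i = 1 &
        forall A : set (measurableTypeR R), measurable A ->
          mu A = (\sum_(i < n) (p i)%:E * pushforward01 mu (Phi i) A)%E].

(* Equality is only required on Borel sets, since mu is a total function. *)
Definition point_mass mu : Prop :=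
  exists x : R, forall A : set (measurableTypeR R),
    measurable A -> mu A = \d_x A.

Definition fourier mu (xi : R) : R[i] :=
  let angle (t : measurableTypeR R) : R := - (2 * pi * xi * t) in
  ((\int[mu]_t cos (angle t)) +i* (\int[mu]_t sin (angle t)))%C.

(* The cast gives the complex numbers R[i] their norm topology. *)
Definition rajchman mu : Prop :=
  let mu_hat : R -> (R[i] : numFieldType)^o := fourier mu in
  (mu_hat xi @[xi --> +oo] --> (0 : (R[i] : numFieldType)^o)) /\
  (mu_hat xi @[xi --> -oo] --> (0 : (R[i] : numFieldType)^o)).

End measures.

(* Main.v *)
(* The IFS consists of f_0(x) = x/9 + b(x) and f_1(x) = (x + 1)/9, where b is a
   smooth function vanishing exactly on [0,1/2].  Its attractor lies in [0,1/8],
   where both maps are affine, so the self-conformal measure with weights 1/2 is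
   a self-similar Cantor measure mu.  Since 9 f_i(t) = t + i on the attractor,
   xi = 9^k gives the same Fourier coefficient for every k, and its real part is
   at least cos(pi/4) because mu is carried by [0,1/8].

   If h conjugates this IFS to affine maps, then h linearizes f_0 near its fixed
   point 0; as h has a nonzero derivative at 0, it is affine on [0,1/2].  Since
   f_1 maps [0,1] into [0,1/2], h is then affine on [0,1], and hence so is f_0,
   which contradicts f_0(1) > 1/9. *)

Require Import Defs.
From HB Require Import structures.
From mathcomp Require Import all_boot all_order all_algebra.
From mathcomp Require Import all_classical all_reals all_analysis.
From mathcomp Require Import measurable_realfun complex ring lra.

Import Order.TTheory GRing.Theory Num.Theory numFieldNormedType.Exports.
Local Open Scope classical_set_scope.
Local Open Scope ring_scope.

(** * Flat functions built from exp(-1/t) *)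

Section flat.
Context {R : realType}.
Implicit Types (p : {poly R}) (t : R).

(* The functions p(1/t) exp(-1/t), extended by 0 to t <= 0, are closed under
   differentiation, hence smooth. *)
Definition flat p t : R := if 0 < t then p.[t^-1] * expR (- t^-1) else 0.

(** The exponential series dominates each of its terms, so s^i <= i! exp(s) for s >= 0; weighting by
    the coefficients gives C. *)
Lemma horner_le_expR p : exists C : R, forall s, 0 <= s -> `|p.[s]| <= C * expR s.
Proof.
exists (\sum_(i < size p) `|p`_i| * i`!%:R) => s s0.
rewrite horner_coef (le_trans (ler_norm_sum _ _ _))// mulr_suml ler_sum// => i _.
rewrite normrM -mulrA ler_wpM2l// ger0_norm ?exprn_ge0//.
case: (nat_of_ord i) => [|n].
  by rewrite expr0 fact0 mul1r -expR0 ler_expR.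
rewrite mulrC -ler_pdivrMr ?ltr0n ?fact_gt0//.
by apply: le_trans (expR_ge1Dxn n s0); rewrite lerDr.
Qed.

(** With s = 1/t, the previous bound for p(s) s^2 says that p(s) exp(-s) is at most C t^2. A
    quadratic bound is what differentiability at 0 requires. *)
Lemma flat_le_sqr p : exists C : R, forall t, `|flat p t| <= C * t ^+ 2.
Proof.
have [C HC] := horner_le_expR (p * 'X^2).
exists `|C| => t; rewrite /flat; case: ifPn => [t0|_]; last first.
  by rewrite normr0 mulr_ge0// sqr_ge0.
have ti0 : 0 < t^-1 by rewrite invr_gt0.
have := HC _ (ltW ti0); rewrite hornerM hornerXn => H.
rewrite normrM (ger0_norm (expR_ge0 _)).
have -> : p.[t^-1] = p.[t^-1] * t^-1 ^+ 2 * t ^+ 2.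
  by rewrite -mulrA -exprMn mulVf ?gt_eqF// expr1n mulr1.
rewrite normrM (ger0_norm (sqr_ge0 t)) mulrAC ler_wpM2r ?sqr_ge0//.
rewrite expRN -ler_pdivlMr ?invr_gt0 ?expR_gt0// invrK.
by apply: (le_trans H); rewrite ler_wpM2r ?expR_ge0// ler_norm.
Qed.

(** Chain rule in s = 1/t: p(s) exp(-s) has s-derivative (p' - p)(s) exp(-s), and ds/dt = -s^2. *)
Definition flat_deriv p : {poly R} := 'X^2 * (p - p^`()).

Lemma is_derive_flat p t : is_derive t 1 (flat p) (flat (flat_deriv p) t).
Proof.
have [t0|t0|->] := ltgtP t 0.
- rewrite /flat ltNge ltW//=.
  apply: (@near_eq_is_derive _ _ _ (cst 0)).
  near=> y; rewrite ltNge ltW//=.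
  by near: y; apply: lt_nbhsl.
- rewrite /flat t0.
  apply: (@near_eq_is_derive _ R R (fun y : R => p.[y^-1] * expR (- y^-1))).
  + near=> y; rewrite ifT//; near: y; apply: lt_nbhsr => //.
  + have dinv : is_derive t 1 (fun y : R => y^-1) (- t ^- 2).
      apply: is_derive_eq; first by apply: (@is_deriveV _ id t 1 1); rewrite gt_eqF.
      by rewrite /= scaler1 -exprVn.
    have d1 : is_derive t 1 (horner p \o (fun y : R => y^-1)) (p^`().[t^-1] * - t ^- 2).
      exact: is_derive1_comp.
    have d2 : is_derive t 1 (expR \o (fun y : R => - y^-1)) (expR (- t^-1) * - - t ^- 2).
      by apply: is_derive1_comp; exact: is_deriveN.
    have d3 := is_deriveM d1 d2.
    apply: (@is_derive_eq _ _ _ _ _ _ _ _ d3).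
    by rewrite /flat_deriv !hornerE -!exprVn /GRing.scale/=; ring.
- have [C HC] := flat_le_sqr p.
  apply/is_derive1_caratheodory.
  (* This is the slope at 0. As division by 0 yields 0, its value there is 0, the required
     derivative; the quadratic bound makes it continuous. *)
  exists (fun y => flat p y / y); split.
  + move=> y; rewrite /flat ltxx !subr0.
    have [->|y0] := eqVneq y 0; first by rewrite mulr0 ltxx.
    by rewrite divfK.
  + have e0 : flat p 0 / 0 = 0 by rewrite invr0 mulr0.
    rewrite /prop_for /continuous_at /= e0.
    have HCt : forall y, `|flat p y / y| <= C * `|y|.
      move=> y; have [->|y0] := eqVneq y 0.
        by rewrite invr0 !normr0 mulr0 normr0 mulr0.
      by rewrite normrM normfV ler_pdivrMr ?normr_gt0// -mulrA -expr2 -normrX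
        (ger0_norm (sqr_ge0 y)).
    apply/norm_cvg0P.
    apply: (@squeeze_cvgr _ _ _ _ (cst 0) (fun y => C * `|y|)).
    * by near=> y; rewrite /= normr_ge0 HCt.
    * exact: cvg_cst.
    * rewrite -[X in _ --> X](mulr0 C); apply: cvgMr.
      by apply/norm_cvg0P; apply: cvg_id.
  + by rewrite /flat ltxx invr0 mulr0.
Unshelve. all: by end_near. Qed.

End flat.

(** * Differentiation relative to [0,1] *)

Section calculus01.
Context {R : realType}.
Implicit Types (f g : R -> R) (x : R).

(** Properness makes the limit defining [derive01] unique. Points of [0,1] approach x from the right
    if x < 1, and from the left otherwise. *)
Lemma within_I01_proper x : I01 x -> ProperFilter (within I01 x^').
Proof.
rewrite /I01/= in_itv/= => /andP[x0 x1].
apply: Build_ProperFilter_ex => A H.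
have {}H : \forall y \near x, y != x -> I01 y -> A y by exact: H.
have [lt1|ge1] := ltP x 1.
- have H' : \forall y \near x^'+, y != x -> I01 y -> A y by exact: cvg_within H.
  apply: (@filter_ex _ x^'+ _ A).
  near=> y; have Hy : y != x -> I01 y -> A y by near: y; exact: H'.
  apply: Hy.
    by near: y; exact: nbhs_right_neq.
  have xy : x <= y by near: y; exact: nbhs_right_ge.
  have y1 : y <= 1 by near: y; exact: nbhs_right_le.
  by rewrite /I01/= in_itv/= y1 (le_trans x0).
- have H' : \forall y \near x^'-, y != x -> I01 y -> A y by exact: cvg_within H.
  apply: (@filter_ex _ x^'- _ A).
  near=> y; have Hy : y != x -> I01 y -> A y by near: y; exact: H'.
  apply: Hy.
    by near: y; exact: nbhs_left_neq.
  have yx : y <= x by near: y; exact: nbhs_left_le.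
  have y0 : 0 <= y by near: y; apply: nbhs_left_ge; exact: lt_le_trans ge1.
  by rewrite /I01/= in_itv/= y0 (le_trans yx).
Unshelve. all: by end_near. Qed.

(** Bridge from ordinary derivatives: f need only agree with g on [0,1], where its difference
    quotient is the Caratheodory slope of g. *)
Lemma cvg_quotient_near f g x d : I01 x -> (forall y, I01 y -> f y = g y) ->
  is_derive x 1 g d -> quotient_near f x --> d.
Proof.
move=> Ix fg /is_derive1_caratheodory[q [gq cq <-]].
have : q y @[y --> within I01 x^'] --> q x.
  by apply: cvg_trans cq; apply: cvg_app => A xA; apply: cvg_within; apply: cvg_within.
apply: cvg_trans; apply: near_eq_cvg.
have H : \forall y \near within I01 x^', I01 y /\ y != x.
  by apply: (@filterE _ (nbhs x)) => y yx Iy.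
near=> y.
have [Iy yx] : I01 y /\ y != x by near: y.
by rewrite !fg// gq mulfK// subr_eq0.
Unshelve. all: by end_near. Qed.

Lemma derive01E f g x d : I01 x -> (forall y, I01 y -> f y = g y) ->
  is_derive x 1 g d -> derive01 f x = d.
Proof.
move=> Ix fg dg; have PF := within_I01_proper _ Ix.
by apply: cvg_lim; [exact: norm_hausdorff|exact: (cvg_quotient_near _ _ _ _ Ix fg dg)].
Qed.

(** Adding an affine part keeps the family closed under differentiation, and the shift places the
    flat point at 1/2. *)
Definition affine_flat (a b : R) (p : {poly R}) (x : R) : R :=
  a * x + b + flat p (x - 2^-1).

Lemma is_derive_affine_flat a b p x :
  is_derive x 1 (affine_flat a b p) (affine_flat 0 a (flat_deriv p) x).
Proof.
have d1 : is_derive x 1 (fun y : R => y - 2^-1) 1.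
  exact: is_derive_shift.
have d2 := @is_derive1_comp _ (flat p) (fun y : R => y - 2^-1) x _ _
  (is_derive_flat p _) d1.
have d3 : is_derive x 1 (fun y : R => a * y + b) a.
  by apply: is_derive_eq; rewrite addr0 /GRing.scale/= mulr1.
have d4 := is_deriveD d3 d2.
apply: (@is_derive_eq _ _ _ _ _ _ _ _ d4).
by rewrite /affine_flat mul0r add0r mulr1.
Qed.

Lemma derive01_affine_flat f a b p : (forall x, I01 x -> f x = affine_flat a b p x) ->
  forall x, I01 x -> derive01 f x = affine_flat 0 a (flat_deriv p) x.
Proof. by move=> fE x Ix; exact: (derive01E _ _ _ _ Ix fE (is_derive_affine_flat a b p x)). Qed.

(** Each iterated derivative agrees on [0,1] with another member of the family, hence is continuous
    and derivable there. *)
Lemma affine_flat_Cinfty01 a b p : Cinfty01 (affine_flat a b p).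
Proof.
have H k : exists a' b' p', forall x, I01 x ->
    iter k derive01 (affine_flat a b p) x = affine_flat a' b' p' x.
  elim: k => [|k [a' [b' [p' IH]]]]; first by exists a, b, p.
  by exists 0, a', (flat_deriv p') => x Ix /=; exact: (derive01_affine_flat _ _ b' _ IH).
move=> r k _; have [a' [b' [p' E]]] := H k; split.
  apply: (@subspace_eq_continuous _ _ _ (affine_flat a' b' p')).
    by move=> x /set_mem Ix; rewrite /from_subspace E.
  apply: continuous_subspaceT => x.
  apply/differentiable_continuous/derivable1_diffP.
  by case: (is_derive_affine_flat a' b' p' x).
move=> _ x Ix; apply/cvg_ex.
exists (affine_flat 0 a' (flat_deriv p') x).
exact: (cvg_quotient_near _ _ _ _ Ix E (is_derive_affine_flat _ _ _ _)).
Qed.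

End calculus01.

(** * Rigidity of conjugacies to affine maps *)

Section conjugacy.
Context {R : realType}.
Implicit Types h k f : R -> R.

Lemma I01E (x : R) : I01 x <-> 0 <= x <= 1.
Proof. by rewrite /I01/= in_itv. Qed.

(** The difference quotients of h at x and of k at h x multiply to 1, which is impossible in the
    limit if the first tends to 0. *)
Lemma derive01_inverse_neq0 h k (x : R) : I01 x -> set_fun I01 I01 h ->
  (forall y, I01 y -> k (h y) = y) -> derivable01 h x -> derivable01 k (h x) ->
  derive01 h x != 0.
Proof.
move=> Ix hI kh dh dk; set c := derive01 h x.
have PF := within_I01_proper _ Ix.
have cdh : quotient_near h x --> c := dh.
have cdk : quotient_near k (h x) --> derive01 k (h x) := dk.
have nI : \forall y \near within I01 x^', I01 y /\ y != x.
  by apply: (@filterE _ (nbhs x)) => y yx Iy.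
have yx0 : y - x @[y --> within I01 x^'] --> 0.
  rewrite -[X in _ --> X](subrr x); apply: cvgB; last exact: cvg_cst.
  by apply: cvg_trans (@cvg_id _ (nbhs x)) => A xA; do 2 apply: cvg_within.
have hcts : h y @[y --> within I01 x^'] --> h x.
  have : (h y - h x) / (y - x) * (y - x) + h x @[y --> within I01 x^'] --> c * 0 + h x.
    exact: (cvgD (cvgM cdh yx0) (cvg_cst _)).
  rewrite mulr0 add0r; apply: cvg_trans; apply: near_eq_cvg; near=> y.
  have [Iy yx] : I01 y /\ y != x by near: y.
  by rewrite divfK ?subr_eq0// subrK.
(* Continuity brings h y to h x and injectivity keeps them distinct, so the quotient of k may be
   composed with h. *)
have hfilter : h y @[y --> within I01 x^'] --> within I01 (h x)^'.
  move=> A hA.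
  have {}hA : \forall z \near h x, z != h x -> I01 z -> A z by exact: hA.
  have := hcts _ hA; rewrite /nbhs/=.
  apply: filterS2 nI => y [Iy yx] /=; apply; last exact: hI.
  by apply: contra_neq yx => /(congr1 k); rewrite !kh.
have : (h y - h x) / (y - x) * ((k (h y) - k (h x)) / (h y - h x))
    @[y --> within I01 x^'] --> c * derive01 k (h x).
  exact: (cvgM cdh (cvg_comp _ _ hfilter cdk)).
move=> H; apply/eqP => c0.
have : (1 : R) @[y --> within I01 x^'] --> c * derive01 k (h x).
  apply: cvg_trans H; apply: near_eq_cvg; near=> y.
  have [Iy yx] : I01 y /\ y != x by near: y.
  have hyx : h y - h x != 0.
    by rewrite subr_eq0; apply: contra_neq yx => /(congr1 k); rewrite !kh.
  by rewrite !kh// mulf_div [X in _ / X]mulrC mulfV// mulf_neq0// subr_eq0.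
rewrite c0 mul0r => H1.
have /eqP : (0 : R) = 1 by apply: cvg_unique H1 (cvg_cst (1 : R)); exact: norm_hausdorff.
by rewrite eq_sym oner_eq0.
Unshelve. all: by end_near. Qed.

(* For u n := (h (q^n y) - h 0) / (q^n y) the functional equation gives
   u n.+1 = (a / q) u n, while u n tends to h'(0) != 0.  Hence a = q, and u is
   constant. *)
Lemma linearization_eq_affine h (a b q r : R) : 0 < q < 1 -> 0 < r <= 1 ->
  derivable01 h 0 -> derive01 h 0 != 0 ->
  (forall y : R, 0 <= y <= r -> h (q * y) = a * h y + b) ->
  forall y : R, 0 <= y <= r -> h y = h 0 + derive01 h 0 * y.
Proof.
move=> /andP[q0 q1] /andP[r0 r1] dh; set c := derive01 h 0 => c0 hq y /andP[].
rewrite le_eqVlt => /predU1P[<- _|y0 yr]; first by rewrite mulr0 addr0.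
have b0 : b = h 0 - a * h 0.
  have := hq 0; rewrite mulr0 lexx ltW// => /(_ isT) h0E.
  by rewrite [X in X - _]h0E addrC addKr.
pose u n := (h (q ^+ n * y) - h 0) / (q ^+ n * y).
have qn0 n : 0 < q ^+ n * y by rewrite mulr_gt0// exprn_gt0.
have qnr n : q ^+ n * y <= r.
  by apply: le_trans yr; rewrite (ler_piMl (ltW y0))// exprn_ile1// ltW.
have uc : u n @[n --> \oo] --> c.
  have cdh : quotient_near h 0 --> c := dh.
  have : q ^+ n * y @[n --> \oo] --> within I01 (0 : R)^'.
    have c1 : q ^+ n * y @[n --> \oo] --> (0 : R).
      rewrite -[X in _ --> X](mul0r y); apply: cvgM; last exact: cvg_cst.
      by apply: cvg_expr; rewrite ger0_norm// ltW.
    move=> A hA.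
    have {}hA : \forall z \near (0:R), z != 0 -> I01 z -> A z by exact: hA.
    have := c1 _ hA; rewrite /nbhs/=; apply: filterS => n; apply.
      by rewrite gt_eqF.
    by apply/I01E; rewrite ltW//= (le_trans (qnr n)).
  move=> H; have := cvg_comp _ _ H cdh.
  by apply: cvg_trans; apply: near_eq_cvg; near=> n; rewrite /u /= subr0.
have uS n : u n.+1 = a / q * u n.
  rewrite /u exprS -mulrA hq ?qnr ?andbT; last exact: ltW.
  rewrite b0 mulf_div; congr (_ / _); ring.
have ucS : u n.+1 @[n --> \oo] --> c by rewrite cvg_shiftS.
have aq : a / q = 1.
  have ucS' : u n.+1 @[n --> \oo] --> a / q * c.
    under eq_fun do rewrite uS.
    exact: cvgMr.
  by apply: (mulIf c0); rewrite mul1r; apply: cvg_unique ucS' ucS; exact: norm_hausdorff.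
have uE n : u n = u 0%N by elim: n => // n IH; rewrite uS aq mul1r.
have -> : c = u 0%N.
  apply: (cvg_unique _ uc); first exact: norm_hausdorff.
  by rewrite (_ : u = cst (u 0%N)); [exact: cvg_cst|exact/funext].
by rewrite /u expr0 mul1r divfK ?gt_eqF// addrC subrK.
Unshelve. all: by end_near. Qed.

Lemma conjugate_affine_endpoint h f0 f1 (q r a b a' b' : R) :
  0 < q < 1 -> 0 < r <= 1 -> 2 * q <= r ->
  derivable01 h 0 -> derive01 h 0 != 0 ->
  (forall y : R, 0 <= y <= r -> f0 y = q * y) ->
  (forall y : R, I01 y -> f1 y = q * (y + 1)) ->
  (forall y, I01 y -> h (f0 y) = a * h y + b) ->
  (forall y, I01 y -> h (f1 y) = a' * h y + b') ->
  I01 (f0 1) -> f0 1 = q.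
Proof.
move=> q01 r01 qr dh; set c := derive01 h 0 => c0 f0E f1E hf0 hf1 f01I.
have /andP[q0 q1] := q01; have /andP[r0 r1] := r01.
have hlin y : 0 <= y <= r -> h y = h 0 + c * y.
  apply: (@linearization_eq_affine h a b q r) => // {}y /andP[y0 yr].
  by rewrite -f0E ?y0// hf0//; apply/I01E; rewrite y0 (le_trans yr).
(* f1 sends [0,1] into [q, 2q], inside [0, r] where h is already affine; the conjugacy of f1 then
   determines h on all of [0,1]. *)
have key y : 0 <= y <= 1 -> h 0 + c * (q * (y + 1)) = a' * h y + b'.
  move=> /[dup] /andP[y0 y1] /I01E Iy; rewrite -hf1// f1E// [RHS]hlin//.
  apply/andP; split; first by rewrite mulr_ge0 ?addr_ge0// ltW.
  rewrite (le_trans _ qr)// mulrC ler_pM2r//; lra.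
have k0 := key 0 ltac:(lra); have kr := key r ltac:(lra).
rewrite (hlin r) in kr; last lra.
have cr0 : c * r != 0 by rewrite mulf_neq0// gt_eqF.
(* Subtracting [key] at 0 from [key] at r leaves c q r = a' c r. *)
have a'q : a' = q by apply: (mulIf cr0); lra.
have haff y : 0 <= y <= 1 -> h y = h 0 + c * y.
  by move=> /key ky; apply: (mulfI (lt0r_neq0 q0)); rewrite a'q in k0 ky; lra.
have f0_le y : 0 <= y <= r -> h 0 + c * (q * y) = a * (h 0 + c * y) + b.
  move=> /[dup] yr /andP[y0 ?]; rewrite -[in RHS]hlin// -hf0; last first.
    by apply/I01E; rewrite y0 (le_trans _ r1).
  rewrite f0E// [RHS]haff//; apply/andP; split; first exact: mulr_ge0 (ltW q0) y0.
  by apply: mulr_ile1 => //; [exact: ltW|exact: ltW|exact: le_trans r1].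
have e0 := f0_le 0 ltac:(lra); have er := f0_le r ltac:(lra).
have aq : a = q by apply: (mulIf cr0); lra.
have I1 : I01 (1 : R) by apply/I01E; rewrite ler01 lexx.
(* With a = q and h affine on [0,1], subtracting the relation at 0 leaves c f0(1) = c q. *)
have := hf0 1 I1; rewrite (haff _ (proj1 (I01E _) f01I)) (haff _ (proj1 (I01E _) I1)).
by rewrite aq in e0 *; move=> e1; apply: (mulfI c0); lra.
Qed.

End conjugacy.

(** * The smooth IFS and its non-conjugacy to self-similar ones *)

Section bumped_ifs.
Context {R : realType}.

(** The factor 1/9 keeps the flat term below 1/9 and its derivative below 2/9, so both maps preserve
    [0,1] with derivatives between 1/9 and 1/3. The second map stays affine, as the rigidity
    argument requires. *)
Definition bump (i : 'I_2) : {poly R} := if i == ord0 then (9^-1)%:P else 0.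

Definition bumped_ifs (i : 'I_2) : R -> R := affine_flat 9^-1 (i%:R / 9) (bump i).

Lemma flat0 (t : R) : flat 0 t = 0.
Proof. by rewrite /flat horner0 mul0r if_same. Qed.

Lemma bumped_ifs_le (i : 'I_2) x : x <= 2^-1 -> bumped_ifs i x = (x + i%:R) / 9.
Proof.
by move=> x1; rewrite /bumped_ifs /affine_flat /flat ltNge subr_le0 x1/= addr0; lra.
Qed.

Lemma flat_bump_bounds i (t : R) : 0 <= flat (bump i) t <= 9^-1.
Proof.
rewrite /bump; case: ifP => _; last by rewrite flat0; lra.
rewrite /flat; case: ifPn => [t0|_]; last lra.
have p9 : 0 <= (9^-1 : R) by lra.
rewrite hornerC mulr_ge0 ?expR_ge0//= ler_piMr//.
by rewrite -expR0 ler_expR oppr_le0 invr_ge0 ltW.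
Qed.

(** For s = 1/t, exp(s) >= 1 + s^2/2 gives s^2 exp(-s) <= 2. *)
Lemma flat_deriv_bump_bounds i (t : R) : 0 <= flat (flat_deriv (bump i)) t <= 2 / 9.
Proof.
rewrite /bump; case: ifP => _; last first.
  by rewrite /flat_deriv deriv0 subr0 mulr0 flat0; lra.
rewrite /flat; case: ifPn => [t0|_]; last lra.
rewrite /flat_deriv derivC subr0 !hornerE.
have s0 : 0 <= t^-1 by rewrite invr_ge0 ltW.
have := expR_ge1Dxn 1 s0; rewrite (_ : 2`! = 2)%N// => H.
rewrite expRN; apply/andP; split.
  by rewrite !mulr_ge0 ?invr_ge0 ?expR_ge0 ?exprn_ge0//; lra.
by rewrite ler_pdivrMr ?expR_gt0//; lra.
Qed.

Lemma bumped_ifs_Cinfty i : Cinfty01 (bumped_ifs i).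
Proof. exact: affine_flat_Cinfty01. Qed.

Lemma bumped_ifs_I01 i : set_fun I01 I01 (bumped_ifs i).
Proof.
move=> x /I01E x01; apply/I01E; rewrite /bumped_ifs /affine_flat.
have := flat_bump_bounds i (x - 2^-1).
have : 0 <= (i%:R : R) <= 1 by case: i => -[|[]]//= _; lra.
lra.
Qed.

Lemma bumped_ifs_self_conformal : self_conformal_ifs bumped_ifs.
Proof.
split=> [i|].
  split; [exact: bumped_ifs_I01|exact: bumped_ifs_Cinfty|move=> x Ix].
  rewrite (derive01_affine_flat _ _ _ _ (fun _ _ => erefl) _ Ix) /affine_flat.
  have := flat_deriv_bump_bounds i (x - 2^-1) => H.
  by rewrite ger0_norm; lra.
(* The second map fixes only 1/8, which lies in the region where the first is x/9, with fixed point
   0. *)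
exists ord0, ord_max => -[x [/I01E x01 f0 f1]].
move: f1; rewrite /bumped_ifs /affine_flat /bump/= flat0 => f1.
by move: f0; rewrite bumped_ifs_le/=; lra.
Qed.

Lemma bumped_ifs_not_conjugate m (Psi : 'I_m -> R -> R) :
  self_similar_ifs Psi -> ~ Cr_conjugate 1 bumped_ifs Psi.
Proof.
move=> [_ aff] [h [k [[[hI kI] kh hk hC kC] Psih _]]].
have conj_affine i : exists a b, forall y, I01 y -> h (bumped_ifs i y) = a * h y + b.
  have [j jE] := Psih i; have [a [b ab]] := aff j.
  by exists a, b => y Iy; rewrite -ab; [rewrite jE ?kh//; exact: hI|exact: hI].
have [a [b ab]] := conj_affine ord0; have [a' [b' ab']] := conj_affine ord_max.
have I0 : I01 (0 : R) by apply/I01E; rewrite lexx ler01.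
have I1 : I01 (1 : R) by apply/I01E; rewrite lexx ler01.
have dh : derivable01 h 0 by apply: (hC 0%N _).2.
have dk : derivable01 k (h 0) by apply: (kC 0%N _).2 => //; exact: hI.
have c0 := derive01_inverse_neq0 _ _ _ I0 hI kh dh dk.
have f01 : bumped_ifs ord0 1 = 9^-1 + 9^-1 * expR (- 2) :> R.
  rewrite /bumped_ifs /affine_flat /bump/= /flat.
  rewrite (_ : 1 - 2^-1 = 2^-1 :> R); last lra.
  by rewrite invr_gt0 ltr0n/= invrK hornerC; lra.
have e0 := expR_gt0 (- 2 : R).
suff : bumped_ifs ord0 1 = 9^-1 :> R by rewrite f01; lra.
(* Here q = 1/9 is the contraction ratio, and r = 1/2 is where the flat term starts. *)
apply: (@conjugate_affine_endpoint _ h (bumped_ifs ord0) (bumped_ifs ord_max)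
  9^-1 2^-1 a b a' b') => //; [lra|lra|lra| | |exact: bumped_ifs_I01].
- by move=> y /andP[_ y1]; rewrite bumped_ifs_le//=; lra.
- by move=> y _; rewrite /bumped_ifs /affine_flat /bump/= flat0 addr0 div1r mulrDr mulr1.
Qed.

End bumped_ifs.

(** * Binary digits under Lebesgue measure and their base 9 coding *)

Section doubling.
Context {R : realType}.
Local Notation mR := (measurableTypeR R).

Definition affine_map (a b : R) : mR -> mR := fun x : R => a * x + b.

Lemma measurable_affine_map a b : measurable_fun setT (affine_map a b).
Proof.
by apply: measurable_funD => //; exact: measurable_funM.
Qed.

(** Uniqueness of Lebesgue measure: the rescaled image measure gives half-open intervals their
    length. *)
Lemma lebesgue_measure_affine (a b : R) (A : set mR) : 0 < a -> measurable A ->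
  lebesgue_measure A = (a%:E * lebesgue_measure (affine_map a b @^-1` A))%E.
Proof.
move=> a0 mA.
pose m1 := @measure_function_pushforward__canonical__measure_function_Measure _ _ _ _ _
  (@lebesgue_measure R) _ (measurable_affine_map a b).
pose m : {measure set mR -> \bar R} := mscale (NngNum (ltW a0)) m1.
apply: (@lebesgue_measure_unique _ m) => // _ [[x y] _ <-] /=.
rewrite /mscale/= /pushforward (_ : _ @^-1` _ = `](x - b) / a, (y - b) / a]%classic).
  rewrite !lebesgue_measure_itv/= !lte_fin ltr_pM2r ?invr_gt0// ltrD2r.
  case: ifP => _; last by rewrite mule0.
  rewrite -!EFinB -EFinM; congr EFin.
  by field; rewrite gt_eqF.
apply/seteqP; split => z /=; rewrite /affine_map !in_itv/= ltr_pdivrMr// ler_pdivlMr//;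
  rewrite ltrBlDr lerBrDr mulrC//.
Qed.

(* For x in [0,1[: y0 and y1 are the alternatives for the first binary digit of x,
   applied to the number formed by the remaining digits. *)
Definition dyadic_branch {T} (x : R) (y0 y1 : R -> T) : T :=
  if x < 2^-1 then y0 (2 * x) else y1 (2 * x - 1).

Definition unit_lebesgue : {measure set mR -> \bar R} :=
  mrestr lebesgue_measure (measurable_itv `[0%R, 1%R[).

Lemma unit_lebesgue_setT : unit_lebesgue setT = 1%E.
Proof.
by rewrite /unit_lebesgue/= /mrestr setTI lebesgue_measure_itv/= lte01 oppr0 adde0.
Qed.

Lemma affine_map_preimage_measurable a b (A : set mR) :
  measurable A -> measurable (affine_map a b @^-1` A).
Proof.
by move=> mA; rewrite -[X in measurable X]setTI; apply: measurable_affine_map.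
Qed.

(** The first binary digit is a fair coin independent of the others: the event is the disjoint union
    of preimages under 2x and 2x - 1, each halving the measure. *)
Lemma unit_lebesgue_dyadic_branch (B0 B1 : set mR) : measurable B0 -> measurable B1 ->
  unit_lebesgue [set x : mR | dyadic_branch x B0 B1] =
    (2^-1%:E * unit_lebesgue B0 + 2^-1%:E * unit_lebesgue B1)%E.
Proof.
move=> mB0 mB1; rewrite /unit_lebesgue/= /mrestr.
set I : set mR := [set` `[0, 1[].
have mI : measurable I by exact: measurable_itv.
have mBI0 : measurable (B0 `&` I) by exact: measurableI.
have mBI1 : measurable (B1 `&` I) by exact: measurableI.
have half (B : set mR) b : measurable B ->
    (2^-1%:E * lebesgue_measure B = lebesgue_measure (affine_map 2 b @^-1` B))%E.
  move=> mB; rewrite (@lebesgue_measure_affine 2 b)// muleA -EFinM.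
  by rewrite mulVf// mul1e.
rewrite (half _ 0 mBI0) (half _ (- 1) mBI1) -measureU.
- congr (lebesgue_measure _); apply/seteqP; split => x.
    rewrite /= /dyadic_branch /affine_map /I/= !in_itv/= addr0.
    case: ltP => x12 [Bx /andP[x0 x1]]; [left|right]; split => //; lra.
  rewrite /= /dyadic_branch /affine_map /I/= !in_itv/= addr0.
  by move=> [[Bx x01]|[Bx x01]]; (case: ltP => x12; split => //; lra).
- exact: affine_map_preimage_measurable.
- exact: affine_map_preimage_measurable.
- apply/seteqP; split => // x; rewrite /affine_map /I/= !in_itv/=.
  by move=> -[[_ ?] [_ ?]]; lra.
Qed.

(** On [0,1[ this is 2x mod 1, the shift of binary digits. *)
Definition doubling : mR -> mR := fun x : R => dyadic_branch x id id.

Lemma measurable_dyadic_branch (f g : mR -> mR) :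
  measurable_fun setT f -> measurable_fun setT g ->
  measurable_fun setT ((fun x : R => dyadic_branch x f g) : mR -> mR).
Proof.
move=> mf mg; apply: measurable_fun_ifT.
- by apply: measurable_fun_ltr => //.
- apply: (measurableT_comp mf); have := measurable_affine_map 2 0.
  by congr measurable_fun; apply/funext => x; rewrite /affine_map addr0.
- exact: (measurableT_comp mg (measurable_affine_map 2 (- 1))).
Qed.

Lemma measurable_doubling : measurable_fun setT doubling.
Proof. by apply: measurable_dyadic_branch; exact: measurable_id. Qed.

Lemma unit_lebesgue_doubling (A : set mR) : measurable A ->
  unit_lebesgue (doubling @^-1` A) = unit_lebesgue A.
Proof.
move=> mA; have := unit_lebesgue_dyadic_branch _ _ mA mA.
rewrite -ge0_muleDl ?lee_fin ?invr_ge0// -EFinD.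
rewrite (_ : 2^-1 + 2^-1 = 1 :> R) ?mul1e; last lra.
move=> <-; congr (unit_lebesgue _).
by apply/seteqP; split => x /=; rewrite /doubling /dyadic_branch; case: ifP.
Qed.

(* coding x = \sum_k d_k / 9^k, where d_1, d_2, ... are the binary digits of x. *)
Definition coding_step (g : mR -> mR) : mR -> mR := fun x : R =>
  dyadic_branch x (affine_map 9^-1 0 \o g) (affine_map 9^-1 9^-1 \o g).

Definition coding_approx n : mR -> mR := iter n coding_step (fun=> 0).

Lemma measurable_coding_approx n : measurable_fun setT (coding_approx n).
Proof.
elim: n => [|n IH]; first exact: measurable_cst.
by apply: measurable_dyadic_branch;
  apply: (measurableT_comp (measurable_affine_map _ _) IH).
Qed.

(** The bound 1/8, the sum of all 9^-k, is the fixed point of y -> (y + 1)/9, so [coding_step]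
    preserves it. *)
Lemma coding_approx_bounds n x : 0 <= (coding_approx n x : R) <= 8^-1.
Proof.
elim: n x => [|n IH] x; first by rewrite /coding_approx/=; lra.
rewrite /coding_approx iterS /coding_step /dyadic_branch /affine_map/=.
by case: ifP => _; [have := IH (2 * x)|have := IH (2 * x - 1)];
  rewrite /coding_approx; lra.
Qed.

(** [coding_step] is monotone in g and the iteration starts at 0, the lower bound; with the upper
    bound this yields convergence. *)
Lemma coding_approx_nondecreasing x : nondecreasing_seq (coding_approx ^~ x : nat -> R).
Proof.
apply/nondecreasing_seqP => n; elim: n x => [|n IH] x.
  by have /andP[] := coding_approx_bounds 1 x.
change (coding_step (coding_approx n) x <= coding_step (coding_approx n.+1) x :> R).
rewrite /coding_step /dyadic_branch /affine_map [leLHS]/= [leRHS]/=.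
by case: ifP => _; rewrite lerD2r ler_pM2l ?invr_gt0.
Qed.

Definition coding : mR -> mR := fun x => limn (coding_approx ^~ x : nat -> R).

Lemma coding_approx_cvg x : (coding_approx n x : R) @[n --> \oo] --> (coding x : R).
Proof.
apply: nondecreasing_is_cvgn (coding_approx_nondecreasing x) _.
by exists 8^-1 => _ [n _ <-]; have /andP[] := coding_approx_bounds n x.
Qed.

Lemma measurable_coding : measurable_fun setT coding.
Proof.
apply: (measurable_fun_cvg measurable_coding_approx) => x _.
exact: coding_approx_cvg.
Qed.

Lemma coding_bounds x : 0 <= (coding x : R) <= 8^-1.
Proof.
have c := coding_approx_cvg x; apply/andP; split.
- apply: limr_ge; first exact: cvgP c.
  by apply: nearW => n; have /andP[] := coding_approx_bounds n x.
- apply: limr_le; first exact: cvgP c.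
  by apply: nearW => n; have /andP[] := coding_approx_bounds n x.
Qed.

(** The recursion for the approximations passes to the limit; this fixed-point equation is the
    source of self-similarity. *)
Lemma codingE : coding = coding_step coding.
Proof.
apply/funext => x.
have cS : (coding_approx n.+1 x : R) @[n --> \oo] --> (coding x : R).
  by have := coding_approx_cvg x; rewrite -(cvg_shiftS (fun n => coding_approx n x : R)).
apply: cvg_unique cS _; first exact: norm_hausdorff.
change ((coding_step (coding_approx n) x : R) @[n --> \oo] --> (coding_step coding x : R)).
rewrite /coding_step /dyadic_branch /affine_map.
by case: ifP => _; exact: (cvgD (cvgMr (coding_approx_cvg _)) (cvg_cst _)).
Qed.

End doubling.

(** * The Cantor measure and its self-conformality *)

Section coding_measure.
Context {R : realType}.
Local Notation mR := (measurableTypeR R).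

Definition coding_measure : set mR -> \bar R := pushforward unit_lebesgue coding.

HB.instance Definition _ := Measure.copy coding_measure
  (measure_function_pushforward__canonical__measure_function_Measure
    unit_lebesgue measurable_coding).

Let coding_measure_setT : coding_measure setT = 1%E.
Proof. by rewrite /coding_measure /pushforward preimage_setT unit_lebesgue_setT. Qed.

HB.instance Definition _ :=
  Measure_isProbability.Build _ _ _ coding_measure coding_measure_setT.

Lemma coding_I01 x : I01 (coding x : R).
Proof. by apply/I01E; have := @coding_bounds R x; lra. Qed.

(** Condition on the first binary digit: [codingE] exposes it, and the remaining digits are again
    uniformly distributed. *)
Lemma coding_measureE (A : set mR) : measurable A ->
  coding_measure A = (2^-1%:E * coding_measure (affine_map 9^-1 0 @^-1` A) +
    2^-1%:E * coding_measure (affine_map 9^-1 9^-1 @^-1` A))%E.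
Proof.
move=> mA; have mB b : measurable ((affine_map 9^-1 b \o @coding R) @^-1` A).
  rewrite -[X in measurable X]setTI.
  exact: (measurableT_comp (measurable_affine_map _ _) measurable_coding).
have -> : (2^-1%:E * coding_measure (affine_map 9^-1 0 @^-1` A) +
    2^-1%:E * coding_measure (affine_map 9^-1 9^-1 @^-1` A) =
  unit_lebesgue [set x : mR | dyadic_branch x
    ((affine_map 9^-1 0 \o @coding R) @^-1` A)
    ((affine_map 9^-1 9^-1 \o @coding R) @^-1` A)])%E.
  by rewrite unit_lebesgue_dyadic_branch.
rewrite /coding_measure /pushforward; congr (unit_lebesgue _).
have coding_x x : coding x = coding_step coding x by rewrite -codingE.
by apply/seteqP; split => x /=; rewrite coding_x /coding_step /dyadic_branch /=; case: ifP.
Qed.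

Lemma coding_measure_self_conformal :
  self_conformal_measure (@bumped_ifs R) coding_measure.
Proof.
split.
  rewrite -coding_measure_setT /coding_measure /pushforward; congr (unit_lebesgue _).
  by apply/seteqP; split=> // x _; exact: coding_I01.
exists (fun=> 2^-1); split => [//||A mA].
  by rewrite big_ord_recl big_ord1; lra.
rewrite big_ord_recl big_ord1; apply: (eq_trans (coding_measureE _ mA)).
(* The coding takes values in [0,1/8], where the maps of the IFS are affine. *)
have E (i : 'I_2) b : i%:R / 9 = b -> pushforward01 coding_measure (bumped_ifs i) A =
    coding_measure (affine_map 9^-1 b @^-1` A).
  move=> <-; rewrite /pushforward01 /pushforward /mrestr /= /coding_measure /pushforward.
  congr (unit_lebesgue _); apply/seteqP; split => x /=.
    move=> [+ _]; rewrite bumped_ifs_le.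
      by rewrite /affine_map mulrDl mulrC.
    by have := @coding_bounds R x; lra.
  move=> Ax; split; last exact: coding_I01.
  rewrite bumped_ifs_le; last by have := @coding_bounds R x; lra.
  by move: Ax; rewrite /affine_map mulrDl mulrC.
rewrite (E ord0 0); last by rewrite mul0r.
by rewrite (E _ 9^-1)//; rewrite div1r.
Qed.

(** An atom x of mass 1 would have to be fixed by both x/9 and (x + 1)/9, as each contributes at
    most 1/2. *)
Lemma coding_measure_not_point_mass : ~ point_mass coding_measure.
Proof.
move=> [x muE].
have mx : measurable ([set x] : set mR) by exact: measurable_set1.
have mf b : measurable (affine_map 9^-1 b @^-1` [set x] : set mR).
  exact: affine_map_preimage_measurable.
have := coding_measureE _ mx.
rewrite !(muE : forall A, measurable A -> coding_measure A = _)// !diracE -!EFinM -EFinD => -[].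
rewrite mem_set//.
have [/set_mem/=|_] := boolP (x \in affine_map 9^-1 0 @^-1` [set x]);
  have [/set_mem/=|_] := boolP (x \in affine_map 9^-1 9^-1 @^-1` [set x]);
  rewrite /affine_map /=; lra.
Qed.

(** * Fourier coefficients along the powers of 9 *)

Lemma integrable_unit_lebesgue (g : mR -> R) : measurable_fun setT g ->
  (forall x, `|g x| <= 1) -> unit_lebesgue.-integrable setT (EFin \o g).
Proof.
move=> mg g1; apply: measurable_bounded_integrable => //.
  by rewrite unit_lebesgue_setT ltry.
exists 1; split; first exact: num_real.
by move=> M M1 x _ /=; rewrite (le_trans (g1 x))// ltW.
Qed.

(** Serves two changes of variables: the coding, with m the Cantor measure, and the doubling map,
    with m = [unit_lebesgue] by invariance. *)
Lemma Rintegral_image_unit_lebesgue (m : {measure set mR -> \bar R})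
    (phi : mR -> mR) (g : mR -> R) :
  measurable_fun setT phi ->
  (forall A, measurable A -> m A = unit_lebesgue (phi @^-1` A)) ->
  measurable_fun setT g -> (forall x, `|g x| <= 1) ->
  \int[m]_t g t = \int[unit_lebesgue]_x g (phi x).
Proof.
move=> mphi mE mg g1; rewrite /Rintegral; congr fine.
pose m' := measure_function_pushforward__canonical__measure_function_Measure
  unit_lebesgue mphi.
transitivity (\int[m']_x (g x)%:E)%E.
  by apply: eq_measure_integral => A mA _; exact: mE.
rewrite (@integral_pushforward _ _ _ _ _ _ mphi)//; first exact/measurable_EFinP.
rewrite preimage_setT; apply: integrable_unit_lebesgue => //.
exact: measurableT_comp.
Qed.

Lemma Rintegral_doubling (g : mR -> R) : measurable_fun setT g ->
  (forall x, `|g x| <= 1) ->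
  \int[unit_lebesgue]_x g (doubling x) = \int[unit_lebesgue]_x g x.
Proof.
move=> mg g1; apply/esym/Rintegral_image_unit_lebesgue => //.
  exact: measurable_doubling.
by move=> A mA; rewrite unit_lebesgue_doubling.
Qed.

(** 9 coding(x) is coding(doubling x) plus the first digit, and 2 pi 9^k times a digit is a whole
    number of periods. *)
Lemma cos_coding_doubling k (x : mR) :
  cos (2 * pi * 9 ^+ k.+1 * (coding x : R)) =
  cos (2 * pi * 9 ^+ k * (coding (doubling x) : R)) :> R.
Proof.
rewrite {1}codingE /coding_step /doubling /dyadic_branch /affine_map exprS.
case: ifP => _ /=.
  by congr cos; field.
rewrite -[RHS](@periodicn _ _ _ (pi *+ 2) (@cosD2pi R) (9 ^ k)%N).
by congr cos; rewrite -[_ *+ (9 ^ k)%N]mulr_natl natrX; field.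
Qed.

Lemma measurable_cos_coding (a : R) :
  measurable_fun setT (fun x : mR => cos (a * (coding x : R)) : R).
Proof.
apply: (measurableT_comp (f := @cos R)).
  by apply: continuous_measurable_fun; exact: continuous_cos.
by apply: measurable_funM => //; exact: measurable_coding.
Qed.

Lemma Rintegral_cos_coding k :
  \int[unit_lebesgue]_x cos (2 * pi * 9 ^+ k * (coding x : R)) =
  \int[unit_lebesgue]_x cos (2 * pi * (coding x : R)) :> R.
Proof.
elim: k => [|k <-]; first by under eq_Rintegral do rewrite expr0 mulr1.
under eq_Rintegral do rewrite cos_coding_doubling.
apply: (Rintegral_doubling (fun x => cos (2 * pi * 9 ^+ k * (coding x : R)) : R)).
  exact: measurable_cos_coding.
by move=> x; exact: cos_max.
Qed.

(** As the coding is in [0,1/8], the angle stays in [0, pi/4], where cosine decreases. *)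
Lemma Rintegral_cos_coding_ge :
  cos (pi / 4) <= \int[unit_lebesgue]_x cos (2 * pi * (coding x : R)) :> R.
Proof.
have pi0 := pi_gt0 R.
have <- : \int[unit_lebesgue]_(x in setT) (cst (cos (pi / 4)) x : R) = cos (pi / 4).
  by rewrite Rintegral_cst// unit_lebesgue_setT/= mulr1.
apply: le_Rintegral => //.
- by apply: integrable_unit_lebesgue => // x; exact: cos_max.
- apply: integrable_unit_lebesgue; first exact: measurable_cos_coding.
  by move=> x; exact: cos_max.
move=> x _ /=; have /andP[x0 x1] := @coding_bounds R x.
have pix0 : 0 <= pi * (coding x : R) by rewrite mulr_ge0// ltW.
have pix1 : pi * (coding x : R) <= pi / 8 by rewrite ler_pM2l.
rewrite leNgt ltr_cos ?in_itv/=; [rewrite -leNgt|apply/andP; split|apply/andP; split]; lra.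
Qed.

Lemma Re_fourier_coding_measure k :
  complex.Re (fourier coding_measure (9 ^+ k)) =
  \int[unit_lebesgue]_x cos (2 * pi * (coding x : R)) :> R.
Proof.
rewrite -(Rintegral_cos_coding k).
transitivity (\int[coding_measure]_t cos (2 * pi * 9 ^+ k * (t : R)) : R).
  by apply: eq_Rintegral => t _; exact: cosN.
rewrite (Rintegral_image_unit_lebesgue _ _
  (fun t : mR => cos (2 * pi * 9 ^+ k * (t : R)) : R) measurable_coding)//.
- apply: (measurableT_comp (f := @cos R)).
    by apply: continuous_measurable_fun; exact: continuous_cos.
  exact: measurable_funM.
- by move=> x; exact: cos_max.
Qed.

Lemma coding_measure_not_rajchman : ~ rajchman coding_measure.
Proof.
move=> [/cvgr0Pnorm_lt mu0 _].
have pi0 := pi_gt0 R.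
have c0 : 0 < cos (pi / 4) :> R by apply: cos_gt0_pihalf; lra.
have c0C : 0 < ((cos (pi / 4))%:C)%C :> R[i] by rewrite ltcR.
have [M [_ muM]] := mu0 _ c0C.
(* Since 9^k > k > |M|, the frequency 9^k lies beyond the threshold M. *)
pose k := (Num.truncn `|M|).+1.
have Mk : M < 9 ^+ k.
  rewrite (le_lt_trans (ler_norm M))// (lt_le_trans (truncnS_gt _))//.
  by rewrite -natrX ler_nat ltnW// ltn_expl.
have /lt_geF/negP := muM _ Mk; apply.
rewrite (le_trans _ (normc_ge_Re _))// lecR.
rewrite (le_trans Rintegral_cos_coding_ge)// -(Re_fourier_coding_measure k).
exact: ler_norm.
Qed.

End coding_measure.

Theorem theorem1p1 (R : realType) :
  exists (n : nat) (Phi : 'I_n -> R -> R),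
    [/\ self_conformal_ifs Phi,
        forall i, Cinfty01 (Phi i),
        ~ exists (m : nat) (Psi : 'I_m -> R -> R),
            self_similar_ifs Psi /\ Cr_conjugate 1 Phi Psi &
        exists mu : probability (measurableTypeR R) R,
          [/\ self_conformal_measure Phi mu, ~ point_mass mu & ~ rajchman mu]].
Proof.
exists 2%N, bumped_ifs; split.
- exact: bumped_ifs_self_conformal.
- exact: bumped_ifs_Cinfty.
- by move=> [m [Psi [ss]]]; exact: bumped_ifs_not_conjugate.
- exists coding_measure; split.
  + exact: coding_measure_self_conformal.
  + exact: coding_measure_not_point_mass.
  + exact: coding_measure_not_rajchman.
Qed.
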